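(* Let $G$ be a connected graph with $s$ vertices, $m$ edges, $r$-th weak edge biparticity $\upsilon_r(G)$ and $r$-th edge connectivity $\lambda_r(G)$. Let $K$ be a finite field of characteristic $p$ and let $C_p(G)$ be the incidence matrix code of $G$ over $K$. Then the $r$-th generalized Hamming weight of $C_p(G)$ is given by $$ \delta_r(C_p(G))=\begin{cases} \upsilon_r(G)&\text{if } p\neq 2,\ G\text{ is non-bipartite},\ 1\leq r\leq s,\\ \lambda_r(G)&\text{if }p=2,\ 1\leq r\leq s-1,\\ \lambda_r(G)&\text{if }G\text{ is bipartite},\ 1\leq r\leq s-1. \end{cases} $$
   Context: Graphs are finite and simple. Let $G$ be a graph with vertices $t_1,\ldots,t_s$ and edges $f_1,\ldots,f_m$. The incidence matrix of $G$ over $K$ is the $s\times m$ matrix $A=(a_{ij})$ with $a_{ij}=1$ if $t_i\in f_j$ and $a_{ij}=0$ otherwise. The incidence matrix code $C_p(G)$ is the linear subspace of $K^m$ generated by the rows of $A$. The $r$-th weak edge biparticity $\upsilon_r(G)$ is the minimum number of edges of $G$ whose removal results in a graph with $r$ bipartite connected components, and maybe some non-bipartite connected components (an isolated vertex is a bipartite component). The $r$-th edge connectivity $\lambda_r(G)$ is the minimum number of edges whose removal results in a graph with $r+1$ connected components. For a linear code $C\subset K^m$ (a linear subspace) and $1\leq r\leq \dim_K C$, the $r$-th generalized Hamming weight is $\delta_r(C)=\min\{|\chi(D)| : D\text{ a subspace of }C,\ \dim_K D=r\}$, where $\chi(D)=\{i : \exists\,(a_1,\ldots,a_m)\in D,\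 a_i\neq 0\}$ is the support of $D$. *)

(* Defs.v *)
From HB Require Import structures.
From mathcomp Require Import all_boot all_order all_algebra all_field.

Set Implicit Arguments.
Unset Strict Implicit.
Unset Printing Implicit Defensive.

Import GRing.Theory.
Local Open Scope ring_scope.

(* A finite simple graph on the vertex type T is given by its set of edges,   *)
(* each of which is a set of exactly two vertices.                            *)
Definition simple_graph (T : finType) (G : {set {set T}}) : bool :=
  [forall f in G, #|f| == 2%N].

Definition adj (T : finType) (G : {set {set T}}) : rel T :=
  fun x y => [set x; y] \in G.

Definition connected_graph (T : finType) (G : {set {set T}}) : bool :=
  (0 < #|T|)%N && [forall x, forall y, connect (adj G) x y].

Definition bipartite (T : finType) (G : {set {set T}}) : bool :=
  [exists X : {set T}, forall x, forall y,
     adj G x y ==> ((x \in X) != (y \in X))].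

(* The vertex sets of the connected components; an isolated vertex x gives    *)
(* the component [set x].                                                     *)
Definition components (T : finType) (G : {set {set T}}) : {set {set T}} :=
  equivalence_partition (connect (adj G)) [set: T].

Definition induced (T : finType) (G : {set {set T}}) (V : {set T}) :
    {set {set T}} :=
  [set f in G | f \subset V].

Definition bipartite_components (T : finType) (G : {set {set T}}) :
    {set {set T}} :=
  [set V in components G | bipartite (induced G V)].

(* The minimum is a relation rather than a function, so that no default value *)
(* has to be chosen for the minimum of an empty family.                       *)
Definition is_min (I : Type) (P : I -> Prop) (w : I -> nat) (n : nat) : Prop :=
  (exists2 x, P x & w x = n) /\ (forall x, P x -> (n <= w x)%N).

Definition is_weak_edge_biparticity (T : finType) (G : {set {set T}})
    (r n : nat) : Prop :=
  is_min (fun F : {set {set T}} =>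
            F \subset G /\ #|bipartite_components (G :\: F)| = r)
         (fun F => #|F|) n.

Definition is_edge_connectivity (T : finType) (G : {set {set T}})
    (r n : nat) : Prop :=
  is_min (fun F : {set {set T}} =>
            F \subset G /\ #|components (G :\: F)| = r.+1)
         (fun F => #|F|) n.

Definition incidence_mx (K : finFieldType) (T : finType) (G : {set {set T}}) :
    'M[K]_(#|T|, #|G|) :=
  \matrix_(i, j) ((enum_val i : T) \in (enum_val j : {set T}))%:R.

Definition incidence_code (K : finFieldType) (T : finType)
    (G : {set {set T}}) : {vspace 'rV[K]_#|G|} :=
  <<[seq row i (incidence_mx K G) | i <- enum 'I_#|T|]>>%VS.

Definition code_support (K : finFieldType) (m : nat)
    (D : {vspace 'rV[K]_m}) : {set 'I_m} :=
  [set i | [exists a : 'rV[K]_m, (a \in D) && (a 0 i != 0)]].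

Definition is_gen_hamming_weight (K : finFieldType) (m : nat)
    (C : {vspace 'rV[K]_m}) (r n : nat) : Prop :=
  is_min (fun D : {vspace 'rV[K]_m} => (D <= C)%VS /\ \dim D = r)
         (fun D => #|code_support D|) n.

(* Main.v *)
Require Import Defs.
From HB Require Import structures.
From mathcomp Require Import all_boot all_order all_algebra all_field.

Set Implicit Arguments.
Unset Strict Implicit.
Unset Printing Implicit Defensive.

Import GRing.Theory.

(** For a set H of edges let Z(H), formalized as [edge_kernel], be the space of
    functions x : T -> K with x u + x v = 0 for every edge uv of H.  The code of
    G is the image of the whole function space under the map sending x to its
    edge sums, and the kernel of that map is Z(G).  Hence r-dimensional subcodes
    D correspond to subspaces of dimension r + dim Z(G) containing Z(G), and D is
    supported in a set F of edges exactly when its preimage is contained in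
    Z(G \ F).  The r-th weight is therefore the least size of an F with
    dim Z(G \ F) >= r + dim Z(G).  Deleting one edge removes one linear
    equation, so the dimension grows by at most one at each deletion, and a
    minimal F attains equality ([edge_kernel_IVT]).  This is
    [gen_hamming_weight_edge_cut], which holds in every characteristic.

    The remaining point is to read off dim Z(H) from the graph.  An element of
    Z(H) changes sign along each edge, so on a component it is determined by one
    value.  If that value is nonzero and the characteristic is not 2, the sign is
    a proper 2-colouring of the component; conversely a 2-colouring gives an
    element of Z(H).  So dim Z(H) counts the bipartite components when 2 is
    invertible ([dim_edge_kernel_charN2]).  It counts all components in
    characteristic 2, where signs do not matter ([dim_edge_kernel_char2]), and
    when H is bipartite ([dim_edge_kernel_bipartite]).  For H = G connected,
    dim Z(G) is 0 in the non-bipartite case of odd characteristic and 1 in the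
    two others, which accounts for the shift from r to r + 1 components in the
    definition of edge connectivity. *)

(** * Connected components *)

Section Components.

Variables (T : finType) (H : {set {set T}}).
Implicit Types (x y : T) (V : {set T}).

Lemma adj_sym : symmetric (adj H).
Proof. by move=> x y; rewrite /adj setUC. Qed.

Lemma connect_adjC : connect_sym (adj H).
Proof. exact: sym_connect_sym adj_sym. Qed.

Lemma connect_adj_equiv : {in [set: T] & &, equivalence_rel (connect (adj H))}.
Proof.
by move=> x y z _ _ _; split=> // cxy; apply: (same_connect connect_adjC).
Qed.

Lemma components_partition : partition (components H) [set: T].
Proof. exact: equivalence_partitionP connect_adj_equiv. Qed.

Definition component x : {set T} := pblock (components H) x.

Lemma mem_component x y : (y \in component x) = connect (adj H) x y.
Proof. by rewrite (pblock_equivalence_partition connect_adj_equiv) ?inE. Qed.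

Lemma component_in x : component x \in components H.
Proof. by rewrite pblock_mem // (cover_partition components_partition) inE. Qed.

Lemma component_def V x : V \in components H -> x \in V -> component x = V.
Proof. by case/and3P: components_partition => _ tiP _; apply: def_pblock. Qed.

Lemma component_eq x y : connect (adj H) x y -> component x = component y.
Proof.
by rewrite -mem_component => cxy; rewrite [RHS](component_def (component_in x)).
Qed.

Lemma component_ex V : V \in components H -> exists x, component x = V.
Proof.
move=> PV; have [V0|[x Vx]] := set_0Vmem V; last by exists x; apply: component_def.
by case/and3P: components_partition => _ _ /negP[]; rewrite -V0.
Qed.

Lemma adj_connect_ind (Q : T -> Prop) x :
  Q x -> (forall y z, adj H y z -> Q y -> Q z) ->
  forall y, connect (adj H) x y -> Q y.
Proof.
move=> Qx stepQ y /connectP[s]; elim: s x Qx => [|z s IHs] x Qx /=.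
  by move=> _ ->.
by case/andP=> /stepQ/(_ Qx)/IHs.
Qed.

End Components.

Lemma simple_graphP (T : finType) (H : {set {set T}}) :
  reflect (forall e, e \in H -> exists x y : T, x != y /\ e = [set x; y])
          (simple_graph H).
Proof.
apply: (iffP forall_inP) => simH e He; first exact/cards2P/simH.
exact/cards2P/simH.
Qed.

Lemma simple_graphS (T : finType) (H H' : {set {set T}}) :
  H' \subset H -> simple_graph H -> simple_graph H'.
Proof.
move=> /subsetP sH /forall_inP simH; apply/forall_inP=> e /sH; exact: simH.
Qed.

(** * Functions alternating in sign along edges *)

Section EdgeKernel.

Local Open Scope ring_scope.

Variables (K : finFieldType) (T : finType).
Implicit Types (G H F : {set {set T}}) (e : {set T}) (x : {ffun T -> K^o}).

Definition edge_sum e x : K^o := \sum_(v in e) x v.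

Lemma edge_sum_is_linear e : linear (edge_sum e).
Proof.
move=> a x y; rewrite /edge_sum scaler_sumr -big_split /=.
by apply: eq_bigr => v _; rewrite !ffunE.
Qed.

HB.instance Definition _ e :=
  GRing.isLinear.Build K {ffun T -> K^o} K^o _ (edge_sum e)
    (edge_sum_is_linear e).

Lemma edge_sum2 (u v : T) x : u != v -> edge_sum [set u; v] x = x u + x v.
Proof. by move=> uv; rewrite /edge_sum big_setU1 ?inE //= big_set1. Qed.

Definition edge_kernel H : {vspace {ffun T -> K^o}} :=
  (\bigcap_(e in H) lker (linfun (edge_sum e)))%VS.

Lemma edge_kernelP H x :
  reflect (forall e, e \in H -> edge_sum e x = 0) (x \in edge_kernel H).
Proof.
rewrite memvE; apply: (iffP subv_bigcapP) => kx e /kx.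
  by rewrite -memvE memv_ker lfunE => /eqP.
by move=> ex0; rewrite -memvE memv_ker lfunE; apply/eqP.
Qed.

Lemma edge_kernel_adj H x u v :
  simple_graph H -> x \in edge_kernel H -> adj H u v -> x v = - x u.
Proof.
move=> /forall_inP simH /edge_kernelP kx Huv.
have uv : u != v by have := simH _ Huv; rewrite cards2; case: (u != v).
by have /eqP := kx _ Huv; rewrite edge_sum2 // addrC addr_eq0 => /eqP.
Qed.

(** A general count for Z(H), covering both characteristics: if [sg] is a nowhere
    zero alternating function on the components in B, then any x in Z(H) is a
    constant multiple of [sg] on each of them, because x / sg does not change
    along an edge.  When every x in Z(H) vanishes outside these components, the
    tuple of ratios identifies Z(H) with the functions on B. *)
Lemma dim_edge_kernel H (B : {set {set T}}) (sg : T -> K) :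
    simple_graph H -> B \subset components H ->
    (forall u, component H u \in B -> sg u != 0) ->
    (forall u v, adj H u v -> component H u \in B -> sg v = - sg u) ->
    (forall x u, x \in edge_kernel H -> x u != 0 -> component H u \in B) ->
  \dim (edge_kernel H) = #|B|.
Proof.
move=> simH /subsetP sB sg0 sgN kerB.
pose I := {V : {set T} | V \in B}.
pose spread (c : {ffun I -> K^o}) : {ffun T -> K^o} :=
  [ffun u => oapp (fun V => c V * sg u) 0 (insub (component H u))].
have spread_linear : linear spread.
  move=> a c d; apply/ffunP=> u; rewrite !ffunE.
  case: insub => [V|] /=; last by rewrite scaler0 addr0.
  by rewrite !ffunE mulrDl -mulrA.
pose spreadL : {linear {ffun I -> K^o} -> {ffun T -> K^o}} :=
  HB.pack spread (GRing.isLinear.Build _ _ _ _ spread spread_linear).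
have spreadE c V u : component H u = val V -> spread c u = c V * sg u.
  by move=> uV; rewrite ffunE uV valK.
have inj_spread : lker (linfun spreadL) = 0%VS.
  apply/eqP; rewrite -subv0; apply/subvP=> c.
  rewrite memv_ker lfunE => /eqP/= /ffunP sc0; rewrite memv0.
  apply/eqP/ffunP=> V; rewrite ffunE.
  have [u uV] := component_ex (sB _ (valP V)).
  have /eqP := sc0 u; rewrite (spreadE _ _ _ uV) ffunE mulf_eq0 => /orP[/eqP//|].
  by rewrite (negPf (sg0 _ _)) // uV (valP V).
have im_spread : limg (linfun spreadL) = edge_kernel H.
  apply/eqP; rewrite eqEsubv; apply/andP; split; apply/subvP=> x.
    case/memv_imgP=> c _ ->; rewrite lfunE /=.
    apply/edge_kernelP=> e He.
    have [u [v [uv De]]] := (simple_graphP _ simH) _ He.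
    rewrite De in He *; rewrite edge_sum2 // !ffunE.
    rewrite -(component_eq (connect1 (He : adj H u v))).
    case: insubP => [V BV _|_] /=; last by rewrite addr0.
    by rewrite (sgN u v) // mulrN subrr.
  (* The ratio x / sg on a component can be read at any of its vertices; the
     value 0 covers the empty set, which is not a component. *)
  move=> kx; pose c := [ffun V : I =>
    (if [pick u in val V] is Some u then x u / sg u else 0) : K^o].
  suffices -> : x = linfun spreadL c by rewrite memv_img ?memvf.
  apply/ffunP=> u; rewrite lfunE /= ffunE; case: insubP => [V BV uV|] /=; last first.
    by apply: contraNeq => /(kerB _ _ kx).
  have VP := sB _ (valP V).
  rewrite ffunE; case: pickP => [v Vv|/(_ u)]; last first.
    by rewrite uV mem_component connect0.
  have cvu : connect (adj H) v u.
    by rewrite -mem_component (component_def VP Vv) uV mem_component connect0.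
  have sv0 : sg v != 0 by rewrite sg0 // (component_def VP Vv) (valP V).
  suffices : x u * sg v = x v * sg u.
    by move=> E; rewrite mulrAC -E mulfK.
  move: (cvu).
  have [] // : x u * sg v = x v * sg u /\ component H u \in B.
  apply: (adj_connect_ind (Q := fun u => x u * sg v = x v * sg u /\ _)) cvu.
    by rewrite (component_def VP Vv) (valP V).
  move=> y z yz [E By]; split; last by rewrite -(component_eq (connect1 yz)).
  by rewrite (edge_kernel_adj simH kx yz) (sgN _ _ yz By) mulNr mulrN E.
rewrite -im_spread limg_dim_eq ?inj_spread ?capv0 //.
by rewrite dimvf /dim /= muln1 card_sig.
Qed.


(** Adding an edge intersects Z(H) with the kernel of one linear form, and the
    image of a form has dimension at most 1. *)
Lemma dim_edge_kernelU1 H e :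
  (\dim (edge_kernel H) <= (\dim (edge_kernel (e |: H))).+1)%N.
Proof.
rewrite -(limg_ker_dim (linfun (edge_sum e)) (edge_kernel H)) -addn1 leq_add //.
  apply/dimvS/subvP=> x; rewrite memv_cap memv_ker lfunE /=.
  case/andP=> /edge_kernelP kx /eqP ex0.
  by apply/edge_kernelP=> f /setU1P[->|/kx].
by apply: leq_trans (dimvS (subvf _)) _; rewrite dimvf.
Qed.

Lemma edge_kernel0 : edge_kernel set0 = fullv.
Proof.
apply/eqP; rewrite eqEsubv subvf; apply/subvP=> x _.
by apply/edge_kernelP=> e; rewrite inE.
Qed.

Lemma dim_edge_kernel0 : \dim (edge_kernel set0) = #|T|.
Proof. by rewrite edge_kernel0 dimvf /dim /= muln1. Qed.

(** A discrete intermediate value theorem: the edges of F are put back into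
    G \ F one at a time, and the dimension decreases by at most one each time. *)
Lemma edge_kernel_IVT G F n :
    F \subset G -> (\dim (edge_kernel G) <= n <= \dim (edge_kernel (G :\: F)))%N ->
  exists2 F' : {set {set T}}, F' \subset F & \dim (edge_kernel (G :\: F')) = n.
Proof.
elim: {F}#|F| {-2}F (eqxx #|F|) => [|k IHk] F cardF sFG /andP[leGn lenF].
  exists F => //; apply/eqP; rewrite eqn_leq lenF andbT.
  by move: cardF; rewrite cards_eq0 => /eqP->; rewrite setD0.
move: lenF; rewrite leq_eqVlt => /orP[/eqP Dn|ltnF]; first by exists F.
have /card_gt0P[e Fe] : (0 < #|F|)%N by rewrite (eqP cardF).
have cardFe : #|F :\ e| == k by move: cardF; rewrite (cardsD1 e) Fe.
have sFe : F :\ e \subset F by rewrite subD1set.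
have [||F' sF' <-] := IHk _ cardFe; first exact: subset_trans sFG.
  have DG : G :\: (F :\ e) = e |: (G :\: F).
    apply/setP=> f; rewrite !inE negb_and negbK.
    by case: eqP => // ->; rewrite (subsetP sFG).
  rewrite leGn /= -ltnS; apply: leq_trans ltnF _.
  by rewrite DG dim_edge_kernelU1.
by exists F' => //; apply: subset_trans sFe.
Qed.

(** * Subcodes and edge sets *)

Section Code.

Variable G : {set {set T}}.

Definition incidence_map x : 'rV[K]_#|G| := \row_j edge_sum (enum_val j) x.

Lemma incidence_map_is_linear : linear incidence_map.
Proof. by move=> a x y; apply/rowP=> j; rewrite !mxE linearP. Qed.

HB.instance Definition _ :=
  GRing.isLinear.Build K {ffun T -> K^o} 'rV[K]_#|G| _ incidence_map
    incidence_map_is_linear.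

Lemma incidence_mapE x :
  incidence_map x = \sum_(i < #|T|) x (enum_val i) *: row i (incidence_mx K G).
Proof.
apply/rowP=> j; rewrite mxE summxE /edge_sum big_mkcond /=.
rewrite (reindex _ (onW_bij _ (enum_val_bij T))) /=; apply: eq_bigr => i _.
by rewrite !mxE; case: ifP => _; rewrite ?mulr1 ?mulr0.
Qed.

Lemma limg_incidence : limg (linfun incidence_map) = incidence_code K G.
Proof.
apply/eqP; rewrite eqEsubv; apply/andP; split.
  apply/subvP=> _ /memv_imgP[x _ ->]; rewrite lfunE /= incidence_mapE.
  apply: memv_suml => i _; apply/memvZ/memv_span/map_f.
  by rewrite mem_enum.
apply/span_subvP=> _ /mapP[i _ ->].
suffices -> : row i (incidence_mx K G) =
    linfun incidence_map [ffun v => (v == enum_val i)%:R].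
  by rewrite memv_img ?memvf.
rewrite lfunE /= incidence_mapE (bigD1 i) //= ffunE eqxx scale1r.
rewrite big1 ?addr0 // => k ki; rewrite ffunE (inj_eq enum_val_inj).
by rewrite (negPf ki) scale0r.
Qed.

Lemma lker_incidence : lker (linfun incidence_map) = edge_kernel G.
Proof.
apply/vspaceP=> x; rewrite memv_ker lfunE /=.
apply/eqP/edge_kernelP => [/rowP x0 e Ge|x0].
  by have := x0 (enum_rank_in Ge e); rewrite !mxE enum_rankK_in.
by apply/rowP=> j; rewrite !mxE x0 // enum_valP.
Qed.

Lemma code_supportPn m (D : {vspace 'rV[K]_m}) j (a : 'rV[K]_m) :
  a \in D -> j \notin code_support D -> a 0 j = 0.
Proof.
by rewrite inE => Da; apply: contraNeq => aj; apply/existsP; exists a; rewrite Da.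
Qed.

(** F is the support of D, read as a set of edges: a function whose edge sums form
    a word of D has zero sum on every edge outside F, so the preimage of D, of
    dimension dim D + dim Z(G), lies in Z(G \ F). *)
Lemma edge_set_of_subcode (D : {vspace 'rV[K]_#|G|}) :
    (D <= incidence_code K G)%VS ->
  exists F : {set {set T}}, [/\ F \subset G, #|F| = #|code_support D| &
    (\dim D + \dim (edge_kernel G) <= \dim (edge_kernel (G :\: F)))%N].
Proof.
rewrite -limg_incidence => sDC.
exists [set enum_val j | j in code_support D]; split.
- by apply/subsetP=> _ /imsetP[j _ ->]; apply: enum_valP.
- by rewrite card_imset //; apply: enum_val_inj.
set F := [set _ | _ in _].
set D' := (linfun incidence_map @^-1: D)%VS.
have <- : \dim D' = (\dim D + \dim (edge_kernel G))%N.
  rewrite -(limg_ker_dim (linfun incidence_map)) lpreimK // addnC.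
  rewrite -lker_incidence (capv_idPr _) //.
  by rewrite -lpreim0 lpreimS // sub0v.
apply: dimvS; apply/subvP=> x; rewrite -memv_preim lfunE /= => Dx.
apply/edge_kernelP=> e /setDP[Ge notFe].
have De := enum_rankK_in Ge Ge.
have := code_supportPn (j := enum_rank_in Ge e) Dx.
rewrite mxE De; apply; apply: contra notFe => supp_e.
by rewrite -De imset_f.
Qed.

(** The image of Z(G \ F) works: the kernel Z(G) of the incidence map is contained
    in Z(G \ F), so the dimension drops by exactly dim Z(G). *)
Lemma subcode_of_edge_set F :
  exists D : {vspace 'rV[K]_#|G|}, [/\ (D <= incidence_code K G)%VS,
    (\dim D + \dim (edge_kernel G))%N = \dim (edge_kernel (G :\: F)) &
    (#|code_support D| <= #|F|)%N].
Proof.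
exists (linfun incidence_map @: edge_kernel (G :\: F))%VS; split.
- by rewrite -limg_incidence limgS ?subvf.
- rewrite addnC -(limg_ker_dim (linfun incidence_map) (edge_kernel (_ :\: _))) lker_incidence.
  rewrite (capv_idPr _) //; apply/subvP=> x /edge_kernelP kx.
  by apply/edge_kernelP=> e /setDP[/kx].
rewrite -(card_imset _ enum_val_inj); apply/subset_leq_card/subsetP=> _ /imsetP[j + ->].
rewrite inE => /existsP[_ /andP[/memv_imgP[x kx ->]]].
rewrite lfunE mxE; apply: contraR => notFj.
by apply/eqP/(edge_kernelP _ _ kx); rewrite inE notFj enum_valP.
Qed.

(** The two minima agree because each family dominates the other.  A subcode gives
    an edge set for which the count [beta] may overshoot, which [good_sub] repairs
    by shrinking the set.  Deleting all of G gives the value #|T|, so the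
    bound on r makes the families nonempty. *)
Theorem gen_hamming_weight_edge_cut (beta : {set {set T}} -> nat) r :
    (forall H, H \subset G -> \dim (edge_kernel H) = beta H) ->
    (r + beta G <= #|T|)%N ->
  exists2 w, is_gen_hamming_weight (incidence_code K G) r w
    & is_min (fun F : {set {set T}} =>
                F \subset G /\ beta (G :\: F) = (r + beta G)%N)
             (fun F => #|F|) w.
Proof.
move=> dimE le_rT; set n := (r + beta G)%N in le_rT *.
pose good F := (F \subset G) && (beta (G :\: F) == n).
have goodP F : reflect (F \subset G /\ beta (G :\: F) = n) (good F).
  by apply: (iffP andP) => -[sF /eqP].
have good_sub F : F \subset G -> (n <= beta (G :\: F))%N ->
    exists2 F', good F' & F' \subset F.
  move=> sFG leF; have [|F' sF' dF'] := edge_kernel_IVT (n := n) sFG.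
    by rewrite !dimE ?subsetDl // leq_addl.
  exists F' => //; apply/goodP; rewrite -dimE ?subsetDl //; split=> //.
  exact: subset_trans sFG.
have [|F0 goodF0 _] := good_sub G (subxx G).
  by rewrite -dimE ?subsetDl // setDv dim_edge_kernel0.
case: (arg_minnP (fun F : {set {set T}} => #|F|) goodF0) => F goodF minF.
exists #|F|; last first.
  by split=> [|F' /goodP/minF //]; exists F => //; apply/goodP.
have lbF D : (D <= incidence_code K G)%VS -> \dim D = r ->
    (#|F| <= #|code_support D|)%N.
  move=> /edge_set_of_subcode[F1 [sF1 <-]].
  rewrite !dimE ?subsetDl // => + dimD; rewrite dimD => /good_sub[] // F2 goodF2.
  by move=> /subset_leq_card; apply: leq_trans; apply: minF.
split=> [|D [sDC dimD]]; last exact: lbF.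
have [sFG betaF] := goodP _ goodF.
have [D [sDC]] := subcode_of_edge_set F.
rewrite !dimE ?subsetDl // betaF => /addIn dimD leDF.
by exists D => //; apply/eqP; rewrite eqn_leq leDF lbF.
Qed.

End Code.
End EdgeKernel.

(** * Dimension of the kernel in terms of components *)

Section Balance.

Local Open Scope ring_scope.

Variables (K : finFieldType) (T : finType).
Implicit Types (G H : {set {set T}}).

Lemma dim_edge_kernel_signed H (sg : T -> K) :
    simple_graph H -> (forall u, sg u != 0) ->
    (forall u v, adj H u v -> sg v = - sg u) ->
  \dim (edge_kernel K H) = #|components H|.
Proof.
move=> simH sg0 sgN; apply: (dim_edge_kernel (sg := sg)) => //.
- by move=> u v /sgN.
- by move=> x u _ _; apply: component_in.
Qed.

Lemma dim_edge_kernel_char2 H :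
  simple_graph H -> 2%N \in [pchar K] -> \dim (edge_kernel K H) = #|components H|.
Proof.
move=> simH ch2; apply: (dim_edge_kernel_signed (sg := fun=> 1)) => // *.
  exact: oner_neq0.
by rewrite oppr_pchar2.
Qed.

Lemma signr_coloring (X : {set T}) u v :
  (u \in X) != (v \in X) -> (-1) ^+ (v \in X) = - (-1) ^+ (u \in X) :> K.
Proof. by case: (u \in X); case: (v \in X) => //= _; rewrite ?expr0 ?expr1 ?opprK. Qed.

Lemma dim_edge_kernel_bipartite H :
  simple_graph H -> bipartite H -> \dim (edge_kernel K H) = #|components H|.
Proof.
move=> simH /existsP[X /forallP bipX].
apply: (dim_edge_kernel_signed (sg := fun u => (-1) ^+ (u \in X))) => // u.
  by rewrite signr_eq0.
by move=> v uv; apply: signr_coloring; move/forallP/(_ v)/implyP: (bipX u); apply.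
Qed.

(** On the component of u the function x only takes the values x u and - x u,
    which are different since 2 is invertible; they form the two colour classes. *)
Lemma bipartite_component_of_support H (x : {ffun T -> K^o}) u :
    simple_graph H -> 2%N \notin [pchar K] -> x \in edge_kernel K H -> x u != 0 ->
  component H u \in bipartite_components H.
Proof.
move=> simH ch2 kx xu0; rewrite inE component_in /=.
have N0 : (- x u == x u) = false.
  apply/negbTE; rewrite eq_sym -addr_eq0 -mulr2n -mulr_natr mulf_eq0 (negPf xu0) /=.
  by apply: contra ch2 => two0; rewrite inE.
apply/existsP; exists [set v | x v == x u].
apply/forallP=> y; apply/forallP=> z; apply/implyP.
case/setIdP=> Hyz /subsetP/(_ y); rewrite !inE eqxx mem_component => /(_ isT) cuy.
rewrite (edge_kernel_adj simH kx Hyz).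
have [->|->] : x y = x u \/ x y = - x u.
- apply: (adj_connect_ind (Q := fun y => x y = x u \/ x y = - x u)) cuy; first by left.
  by move=> a b /(edge_kernel_adj simH kx)-> [->|->]; [right|left; rewrite opprK].
- by rewrite eqxx N0.
by rewrite opprK eqxx N0.
Qed.

(** The sign function is glued from a 2-colouring chosen on each bipartite
    component.  The other components add nothing to the count because Z(H)
    vanishes there ([bipartite_component_of_support]). *)
Lemma dim_edge_kernel_charN2 H :
    simple_graph H -> 2%N \notin [pchar K] ->
  \dim (edge_kernel K H) = #|bipartite_components H|.
Proof.
move=> simH ch2.
pose proper V (X : {set T}) := [forall x, forall y,
  adj (induced H V) x y ==> ((x \in X) != (y \in X))].
pose side u : {set T} := odflt set0 [pick X | proper (component H u) X].
apply: (dim_edge_kernel (sg := fun u => (-1) ^+ (u \in side u))) => //.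
- by apply/subsetP=> V; rewrite inE => /andP[].
- by move=> u _; rewrite signr_eq0.
- move=> u v uv; have cuv := connect1 uv.
  rewrite inE => /andP[_ /existsP[X0 properX0]].
  have -> : side v = side u by rewrite /side (component_eq cuv).
  rewrite /side; case: pickP => [X /forallP/(_ u)/forallP/(_ v)/implyP|]; last first.
    by move/(_ X0); rewrite /proper properX0.
  move=> properX; apply/signr_coloring/properX; rewrite /adj /induced in_set.
  rewrite (uv : [set u; v] \in H); apply/subsetP=> w.
  by case/set2P=> ->; rewrite mem_component ?connect0.
by move=> x u kx; apply: bipartite_component_of_support.
Qed.

End Balance.

(** * The connected graph itself, and the theorem *)

Lemma components_connected (T : finType) (G : {set {set T}}) :
  connected_graph G -> components G = [set setT].
Proof.
case/andP=> /card_gt0P[x0 _] /forallP conn.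
have comp x : component G x = setT.
  by apply/setP=> y; rewrite mem_component inE (forallP (conn x)).
apply/setP=> V; rewrite inE; apply/idP/eqP=> [/component_ex[x <-] //|->].
by rewrite -(comp x0) component_in.
Qed.

Lemma bipartite_components_connected (T : finType) (G : {set {set T}}) :
  connected_graph G -> ~~ bipartite G -> bipartite_components G = set0.
Proof.
move=> connG nbipG; apply/setP=> V; rewrite !inE components_connected // inE.
apply/negP=> /andP[/eqP-> bipG]; case/negP: nbipG.
suffices <- : induced G setT = G by [].
by apply/setP=> e; rewrite inE subsetT andbT.
Qed.

Lemma bipartiteS (T : finType) (G H : {set {set T}}) :
  H \subset G -> bipartite G -> bipartite H.
Proof.
move=> /subsetP sHG /existsP[X /forallP bipX]; apply/existsP; exists X.
apply/forallP=> x; apply/forallP=> y; apply/implyP=> /sHG.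
by move/forallP/(_ y)/implyP: (bipX x); apply.
Qed.

Theorem corollary2p13 (T : finType) (G : {set {set T}})
    (simpleG : simple_graph G) (connG : connected_graph G)
    (K : finFieldType) (p : nat) (charK : p \in [pchar K]%R) (r : nat) :
  (p <> 2 -> ~~ bipartite G -> 1 <= r <= #|T| ->
     exists2 w, is_gen_hamming_weight (incidence_code K G) r w
              & is_weak_edge_biparticity G r w) /\
  (p = 2 -> 1 <= r <= #|T| - 1 ->
     exists2 w, is_gen_hamming_weight (incidence_code K G) r w
              & is_edge_connectivity G r w) /\
  (bipartite G -> 1 <= r <= #|T| - 1 ->
     exists2 w, is_gen_hamming_weight (incidence_code K G) r w
              & is_edge_connectivity G r w).
Proof.
have simS (H : {set {set T}}) : H \subset G -> simple_graph H by move/simple_graphS; apply.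
have connectivity : 1 <= r <= #|T| - 1 ->
    (forall H : {set {set T}}, H \subset G -> \dim (edge_kernel K H) = #|components H|) ->
  exists2 w, is_gen_hamming_weight (incidence_code K G) r w
           & is_edge_connectivity G r w.
  case/andP=> _ le_r dimE; have T_gt0 : 0 < #|T| by case/andP: connG.
  have := gen_hamming_weight_edge_cut (r := r) dimE.
  rewrite components_connected // cards1 addn1; apply.
  by rewrite -(subnK T_gt0) addn1 ltnS.
split=> [p2 nbipG /andP[_ le_r]|]; last split=> [p2|bipG] r_range.
- have ch2 : 2 \notin [pchar K]%R.
    by rewrite (pcharf_eq charK) inE eq_sym; apply/eqP.
  have dimE (H : {set {set T}}) : H \subset G ->
      \dim (edge_kernel K H) = #|bipartite_components H|.
    by move=> /simS/dim_edge_kernel_charN2; apply.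
  have := gen_hamming_weight_edge_cut (r := r) dimE.
  by rewrite bipartite_components_connected // cards0 addn0; apply.
- apply: connectivity => // H /simS/dim_edge_kernel_char2; apply.
  by rewrite -p2.
apply: connectivity => // H sHG; apply: dim_edge_kernel_bipartite; first exact: simS.
exact: bipartiteS bipG.
Qed.
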